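(* Let $X$ be a Banach space and let $T$ be a bounded linear operator on $X$ which is frequently hypercyclic and invertible. Then $T^{-1}$ is $\mathcal U$-frequently hypercyclic.
   Context: For $A\subset\mathbb Z_+=\{0,1,2,\dots\}$ let $A(n)=\{a\in A: a\le n\}$, $\underline d(A)=\liminf_{n\to+\infty}\frac{\#A(n)}{n}$ (lower density) and $\bar d(A)=\limsup_{n\to+\infty}\frac{\#A(n)}{n}$ (upper density). A bounded operator $T$ on a Banach space $X$ is frequently hypercyclic (resp. $\mathcal U$-frequently hypercyclic) if there is a vector $x\in X$ such that for every nonempty open $U\subset X$ the set $\{n\in\mathbb Z_+: T^nx\in U\}$ has positive lower density (resp. positive upper density). *)

(* Defs.v *)
From HB Require Import structures.
From mathcomp Require Import all_boot all_order all_algebra.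
From mathcomp Require Import complex.
From mathcomp Require Import boolp classical_sets functions reals ereal.
From mathcomp Require Import topology normedtype sequences.

Set Implicit Arguments.
Unset Strict Implicit.
Unset Printing Implicit Defensive.

Import Order.TTheory GRing.Theory Num.Theory.
Import numFieldNormedType.Exports.

Local Open Scope classical_set_scope.
Local Open Scope ring_scope.

Variant scalars := RealScalars | ComplexScalars.

(* Banach spaces may be real or complex: a Banach space over
   [scalar_field R k] is a complete normed space over the reals [R] or over
   the complex numbers [R[i]], according to [k]. *)
Definition scalar_field (R : realType) (k : scalars) : numFieldType :=
  match k with
  | RealScalars => R
  | ComplexScalars => R[i]
  end.

Section Density.
Variable R : realType.
Implicit Type A : set nat.

(* The indices of ['I_n.+1] are the a with 0 <= a <= n. *)
Definition count_upto A (n : nat) : nat := #|[pred a : 'I_n.+1 | `[< A a >]]|.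

(* The term at n = 0 is a division by zero, whose conventional value 0 has no
   influence on the lower and upper limits. *)
Definition density_ratio A (n : nat) : R := (count_upto A n)%:R / n%:R.

Definition lower_density A : \bar R :=
  limn_einf (fun n => (density_ratio A n)%:E).

Definition upper_density A : \bar R :=
  limn_esup (fun n => (density_ratio A n)%:E).

End Density.

Section Operators.
Variables (K : numFieldType) (X : normedModType K).
Implicit Type T : {linear X -> X}.

Definition bounded_operator T : Prop :=
  exists M : K, forall x : X, `|T x| <= M * `|x|.

Definition return_set T (x : X) (U : set X) : set nat :=
  [set n | U (iter n T x)].

(* [R] is the field of real numbers in which densities are computed. *)
Definition frequently_hypercyclic (R : realType) T : Prop :=
  exists x : X, forall U : set X, open U -> U !=set0 ->
    (0 < lower_density R (return_set T x U))%E.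

Definition U_frequently_hypercyclic (R : realType) T : Prop :=
  exists x : X, forall U : set X, open U -> U !=set0 ->
    (0 < upper_density R (return_set T x U))%E.

End Operators.

(* Main.v *)
(* Let x be frequently hypercyclic for T and y = T^n x.  Since
   T^(-k) y = T^(n-k) x, the orbit of y under T^(-1) visits an open set V at the
   times k <= n as often as the orbit of x under T does; for n large this
   proportion is at least a delta(V) > 0 independent of n.  Such y are dense, so
   for every V of a countable base and every N the open set of those y whose
   T^(-1)-orbit visits V with proportion at least delta(V) up to some n >= N is
   dense, and Baire's theorem provides a vector in all these sets. *)
Require Import Defs.
From HB Require Import structures.
From mathcomp Require Import all_boot all_order all_algebra.
From mathcomp Require Import complex.
From mathcomp Require Import boolp classical_sets functions reals ereal.
From mathcomp Require Import topology normedtype sequences.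
From mathcomp Require Import archimedean ring lra.

Set Implicit Arguments.
Unset Strict Implicit.
Unset Printing Implicit Defensive.

Import Order.TTheory GRing.Theory Num.Theory.
Import numFieldNormedType.Exports.

Local Open Scope classical_set_scope.
Local Open Scope ring_scope.

(** * The archimedean property, common to real and complex scalars *)

Lemma scalar_field_archimedean (R : realType) (k : scalars) :
  Num.archimedean_axiom (scalar_field R k).
Proof.
case: k => /= x; first by exists (Num.bound `|x|); exact: archi_boundP.
have /complex_realP[r xr] : `|x| \is Num.real by exact: normr_real.
exists (Num.bound `|r|); rewrite xr -(rmorph_nat (real_complex R)) ltcR.
exact: le_lt_trans (ler_norm r) (archi_boundP (normr_ge0 r)).
Qed.

(** * Lower and upper densities of sets of integers *)

Section Density.
Variable R : realType.
Implicit Types A B : set nat.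

Lemma density_ratio_le A B n : (forall a, (a <= n)%N -> A a -> B a) ->
  density_ratio R A n <= density_ratio R B n.
Proof.
move=> AB; rewrite ler_wpM2r ?invr_ge0// ler_nat.
apply: subset_leq_card; apply/fintype.subsetP => a.
rewrite !unfold_in => /asboolP Aa.
by apply/asboolP; apply: AB Aa; rewrite -ltnS.
Qed.

(** Time reversal permutes 0, ..., n; it will exchange the visits under T and those under its
    inverse. *)
Lemma density_ratio_rev A n :
  density_ratio R [set a | A (n - a)%N] n = density_ratio R A n.
Proof.
rewrite /density_ratio /count_upto -!sum1_card.
rewrite [in RHS](reindex_inj rev_ord_inj)/=.
by congr (_%:R / _); apply: eq_bigl => a; rewrite !inE/= subSS.
Qed.

Lemma lower_density_gt0 A : (0 < lower_density R A)%E ->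
  exists d : R, 0 < d /\
    exists N, forall n, (N <= n)%N -> d <= density_ratio R A n.
Proof.
rewrite /lower_density /limn_einf /limn_esup -/(limf_einf _ _) limf_einfE.
move=> /ereal_sup_gt[_ [V [N _ NV] <-]].
(* The infimum over the tail [V] is positive and lies below a real ratio, hence is finite: it is the
   required [d]. *)
have : forall n, (N <= n)%N ->
    (ereal_inf [set (density_ratio R A n)%:E | n in V] <=
     (density_ratio R A n)%:E)%E.
  by move=> n Nn; apply: ereal_inf_lbound; exists n => //; exact: NV.
case: ereal_inf => [d|/(_ N (leqnn N))|] // dN d0.
by exists d; split => //; exists N => n /dN; rewrite lee_fin.
Qed.

Lemma density_gt0_nonempty A : (0 < lower_density R A)%E -> A !=set0.
Proof.
move=> /lower_density_gt0[d [d0 [N /(_ N (leqnn N)) dN]]].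
apply: contrapT => A0; suff : density_ratio R A N = 0 by lra.
rewrite /density_ratio /count_upto eq_card0 ?mul0r// => a.
by rewrite inE; apply/asboolP => Aa; apply: A0; exists a.
Qed.

Lemma upper_density_gt0 A (d : R) : 0 < d ->
  (forall N, exists2 n, (N <= n)%N & d <= density_ratio R A n) ->
  (0 < upper_density R A)%E.
Proof.
move=> d0 dA; apply: lt_le_trans (_ : d%:E <= _)%E; first by rewrite lte_fin.
rewrite /upper_density /limn_esup limf_esupE.
apply: le_ereal_inf_tmp => _ [V [N _ NV] <-]; have [n Nn dn] := dA N.
apply: le_trans (_ : (density_ratio R A n)%:E <= _)%E; first by rewrite lee_fin.
by apply: ereal_sup_ubound; exists n => //; exact: NV.
Qed.

End Density.

(** * Baire's theorem over archimedean scalars *)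

Section ArchimedeanNormedModule.
Variable K : numFieldType.
Hypothesis archK : Num.archimedean_axiom K.

Lemma invSn_lt (e : K) : 0 < e ->
  exists k : nat, forall j, (k <= j)%N -> j.+1%:R^-1 < e.
Proof.
move=> e0; have [k ek] := archK e^-1; exists k => j kj.
rewrite invf_plt ?posrE// -(gtr0_norm (x := e^-1)) ?invr_gt0//.
by apply: lt_le_trans ek _; rewrite ler_nat leqW.
Qed.

Lemma closure_ball_sub (X : pseudoMetricType K) (x : X) (r e : K) :
  0 < e -> closure (ball x r) `<=` ball x (r + e).
Proof.
move=> e0 z /(_ _ (nbhsx_ballx z e e0))[w [xw zw]].
exact: ball_triangle xw (ball_sym zw).
Qed.

(* [Baire] in [sequences] covers real scalars only. *)
Lemma Baire_archimedean (X : completeNormedModType K) (F : nat -> set X) :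
  (forall n, open (F n) /\ dense (F n)) -> dense (\bigcap_n F n).
Proof.
move=> oF O [x Ox] oO.
(* Balls are coded by a center and an integer, so that radii tend to 0 when the integers tend to
   infinity. *)
pose B (u : X * nat) := ball u.1 (u.2.+1%:R^-1 : K).
have invS0 j : 0 < j.+1%:R^-1 :> K by rewrite invr_gt0 ltr0Sn.
have small (U : set X) y m : open U -> U y ->
    exists2 j, (m <= j)%N & closure (B (y, j)) `<=` U.
  move=> oU Uy.
  have /nbhs_ballP[e /= e0 yeU] : nbhs y U by exact: open_nbhs_nbhs.
  have e20 : 0 < e / 2 by rewrite divr_gt0.
  have [k ke] := invSn_lt e20; exists (maxn m k); first exact: leq_maxl.
  apply: subset_trans (closure_ball_sub e20) (subset_trans _ yeU).
  apply: le_ball; rewrite [leRHS](splitr e) lerD2r.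
  by apply/ltW/ke; exact: leq_maxr.
(* The bound on [v.2] forces the radii of the nested balls to 0, which makes their centers a Cauchy
   sequence. *)
have step (p : nat * (X * nat)) : exists v : X * nat,
    (p.1 <= v.2)%N /\ closure (B v) `<=` F p.1 `&` B p.2.
  case: p => n [a k] /=; have [oFn dFn] := oF n.
  have [b [Bb Fb]] : ((B (a, k))° `&` F n) !=set0.
    apply: dFn; last exact: open_interior.
    by exists a; exact: nbhsx_ballx.
  have [j nj jU] := small _ _ n (openI (@open_interior _ _) oFn) (conj Bb Fb).
  exists (b, j); split => //; apply: subset_trans jU _ => z [Bz Fz].
  by split => //; exact: interior_subset Bz.
have [f fP] := choice step.
have [k0 _ k0O] := small O x 0%N oO Ox.
pose fix u n := if n is m.+1 then f (m, u m) else (x, k0).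
have uS n : (n <= (u n.+1).2)%N /\ closure (B (u n.+1)) `<=` F n `&` B (u n).
  exact: fP (n, u n).
have nested m n : (m <= n)%N -> B (u n) `<=` B (u m).
  move=> /subnKC <-; elim: (n - m)%N => [|i IH]; first by rewrite addn0.
  rewrite addnS => z Bz; apply: IH.
  by have [_] := (uS (m + i)%N).2 z (subset_closure Bz).
have uB m n : (m <= n)%N -> B (u m) (u n).1.
  by move=> mn; apply: (nested m n mn); exact: ballxx.
have /cauchy_cvg/cvg_ex[l ul] : cauchy ((fun n => (u n).1) @ \oo).
  apply: cauchy_exP => e e0; have [k ke] := invSn_lt e0.
  exists (u k.+1).1; exists k.+1 => // n /= kn.
  by apply: le_ball (uB _ _ kn); apply/ltW/ke; exact: (uS k).1.
have lB n : closure (B (u n)) l.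
  apply: (closed_cvg (closure (B (u n))) (@closed_closure _ _) _ _ ul).
  by exists n => // i /= ni; apply: subset_closure; exact: uB.
exists l; split; first exact: k0O (lB 0%N).
by move=> n _; exact: ((uS n).2 l (lB n.+1)).1.
Qed.

(** * Continuity of bounded operators and the bounded inverse theorem *)

Lemma bounded_operator_continuous (X : normedModType K) (T : {linear X -> X}) :
  bounded_operator T -> continuous T.
Proof.
move=> [M TM]; apply/linear_bounded_continuous/linear_boundedP.
near=> r => x; have TMx := TM x.
(* [M] is an arbitrary scalar, perhaps not real, so [r] is compared with its modulus. *)
rewrite -normr_id; apply: le_trans (_ : `|M * `|x| | <= _).
  by rewrite (ger0_norm (le_trans (normr_ge0 _) TMx)) normr_id.
rewrite normrM normr_id; apply: ler_wpM2r; first exact: normr_ge0.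
by near: r; apply: nbhs_pinfty_ge; exact: normr_real.
Unshelve. all: by end_near. Qed.

(** The sets [E n] cover the space, so by Baire one of them is dense in some ball. Successive
    approximation then writes y as a series whose image under [S] is dominated by a geometric
    series. *)
Lemma bounded_operator_inv (X : completeNormedModType K)
    (T S : {linear X -> X}) :
  bounded_operator T -> cancel T S -> cancel S T -> bounded_operator S.
Proof.
move=> bT TK SK; have cT := bounded_operator_continuous bT.
pose E n := [set y : X | `|S y| <= n%:R].
have [n [y0 [r r0 rE]]] : exists n y0, exists2 r : K, 0 < r &
    ball y0 r `<=` closure (E n).
  apply: contrapT => noE.
  have oFn n : open (~` closure (E n)) /\ dense (~` closure (E n)).
    split; first by apply: closed_openC; exact: closed_closure.
    move=> O [y Oy] oO; apply: contrapT => OE; apply: noE.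
    have /nbhs_ballP[r /= r0 rO] : nbhs y O by exact: open_nbhs_nbhs.
    exists n, y, r => // z /rO Oz; apply: contrapT => nEz.
    by apply: OE; exists z.
  have [|y [_ yF]] := Baire_archimedean oFn _ openT; first by exists 0.
  have [n] := archK `|S y|; rewrite normr_id => Sn.
  by apply: (yF n I); apply: subset_closure; exact: ltW.
pose C : K := 4 * n%:R / r.
have C0 : 0 <= C by rewrite divr_ge0 ?mulr_ge0// ltW.
(* As [E n] is dense in a ball, differences of its points, rescaled, approximate
   any vector; iterating [h] below makes the error tend to 0. *)
have approx y : exists z, `|S z| <= C * `|y| /\ `|y - z| <= `|y| / 2.
  have [->|yN0] := eqVneq y 0.
    by exists 0; rewrite linear0 subr0 normr0 mulr0 mul0r.
  have y_gt0 : 0 < `|y| by rewrite normr_gt0.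
  (* [c *: y] has norm r/2, so [y0 + c *: y] stays in the ball. Errors of r/8 at both points give
     r/4, that is [|y| / 2] after division by [c], while 2n becomes [C * |y|]. *)
  pose c : K := r / (2 * `|y|).
  have yy0 := lt0r_neq0 y_gt0; have rr0 := lt0r_neq0 r0.
  have c0 : 0 < c by rewrite divr_gt0 ?mulr_gt0.
  have r80 : 0 < r / 8 by rewrite divr_gt0.
  have near_E u : ball y0 r u -> exists2 a, `|S a| <= n%:R & `|u - a| < r / 8.
    move=> /rE/(_ _ (nbhsx_ballx u _ r80))[a [Ea]].
    by rewrite -ball_normE /= => ua; exists a.
  have [b Sb yb] := near_E y0 (ballxx y0 r0).
  have [|a Sa ya] := near_E (y0 + c *: y).
    rewrite -ball_normE /= opprD addNKr normrN normrZ gtr0_norm// /c.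
    by rewrite [ltLHS](_ : _ = r / 2) ?gtr_pMr// ?invf_lt1 ?ltr1n//; field.
  exists (c^-1 *: (a - b)); split.
    rewrite linearZ/= linearB/= normrZ gtr0_norm ?invr_gt0//.
    apply: le_trans (_ : c^-1 * (n%:R + n%:R) <= _).
      rewrite ler_wpM2l ?invr_ge0 ?(ltW c0)//.
      by apply: le_trans (ler_normB _ _) _; exact: lerD.
    rewrite /c /C [leLHS](_ : _ = 4 * n%:R / r * `|y|)//; field.
    by rewrite yy0 rr0.
  have -> : y - c^-1 *: (a - b) = c^-1 *: ((y0 + c *: y - a) - (y0 - b)).
    have -> : y0 + c *: y - a - (y0 - b) = c *: y - (a - b).
      by rewrite !opprB addrC -[y0 + _ - a]addrA addrA subrK addrCA.
    by rewrite [RHS]scalerBr scalerA mulVf ?scale1r// lt0r_neq0.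
  rewrite normrZ gtr0_norm ?invr_gt0//.
  apply: le_trans (_ : c^-1 * (r / 8 + r / 8) <= _).
    rewrite ler_wpM2l ?invr_ge0 ?(ltW c0)//.
    by apply: le_trans (ler_normB _ _) _; apply: lerD; exact: ltW.
  by rewrite /c [leLHS](_ : _ = `|y| / 2)//; field; rewrite yy0 rr0.
have [g gP] := choice approx.
pose h y := y - g y.
have h_le m y : `|iter m h y| <= `|y| / 2 ^+ m.
  elim: m => [|m IH]; first by rewrite expr0 divr1.
  rewrite iterS exprSr invfM mulrA; apply: le_trans (gP _).2 _.
  by rewrite ler_wpM2r ?invr_ge0.
(* The factor 2 is the sum of the series 1 + 1/2 + 1/4 + ... *)
have Sh_le m y : `|S (y - iter m h y)| <= 2 * C * `|y|.
  elim: m y => [|m IH] y.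
    by rewrite /= subrr linear0 normr0 mulr_ge0// mulr_ge0.
  rewrite iterSr.
  have -> : y - iter m h (h y) = g y + (h y - iter m h (h y)).
    by rewrite addrA /h [g y + _]addrC subrK.
  rewrite linearD/=; apply: le_trans (ler_normD _ _) _.
  have -> : 2 * C * `|y| = C * `|y| + 2 * C * (`|y| / 2).
    by field.
  apply: lerD; first exact: (gP y).1.
  apply: le_trans (IH _) _; apply: ler_wpM2l; first exact: mulr_ge0.
  exact: (gP y).2.
have h_lt (e : K) y : 0 < e -> exists N, forall m, (N <= m)%N ->
    `|iter m h y| < e.
  move=> e0; have y1_gt0 : 0 < `|y| + 1 by rewrite ltr_wpDl.
  have [N Ne] := invSn_lt (divr_gt0 e0 y1_gt0); exists N => m Nm.
  apply: le_lt_trans (h_le m y) _.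
  apply: le_lt_trans (_ : (`|y| + 1) * m.+1%:R^-1 < _); last first.
    by rewrite mulrC -ltr_pdivlMr//; exact: Ne.
  apply: ler_pM => //; first by rewrite lerDl.
  by rewrite lef_pV2 ?posrE ?exprn_gt0// -natrX ler_nat ltn_expl.
(* The extra 1 absorbs the distance from [S y] to a late term of [x], made smaller than [|y|]
   below. *)
exists (2 * C + 1) => y.
have [->|yN0] := eqVneq y 0; first by rewrite linear0 normr0 mulr0.
have y_gt0 : 0 < `|y| by rewrite normr_gt0.
pose x m := S (y - iter m h y).
have /cauchy_cvg/cvg_ex[l xl] : cauchy (x @ \oo).
  apply: cauchy_exP => e e0.
  have C1_gt0 : 0 < 2 * C + 1 by rewrite ltr_wpDl// mulr_ge0.
  have [N Ne] := h_lt _ y (divr_gt0 e0 C1_gt0).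
  exists (x N), N => // m /= Nm; rewrite -ball_normE /= /x distrC -linearB/=.
  rewrite opprB addrC addrA subrK -(subnK Nm) iterD.
  apply: le_lt_trans (Sh_le _ _) _.
  apply: le_lt_trans (_ : (2 * C + 1) * `|iter N h y| < _).
    by rewrite ler_wpM2r// lerDl.
  by rewrite mulrC -ltr_pdivlMr//; exact: Ne.
(* Continuity of [S] is not yet available; that of [T] identifies the limit [l], since it gives T l
   = y. *)
have Tx : T \o x @ \oo --> y.
  apply/cvgrPdist_lt => e e0; have [N Ne] := h_lt _ y e0.
  by exists N => // m /= Nm; rewrite /x SK subKr; exact: Ne.
have lE : l = S y.
  rewrite -[LHS]TK; congr (S _); apply: (cvg_unique _ _ Tx).
    exact: norm_hausdorff.
  exact: (continuous_cvg _ (cT l) xl).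
have /cvgrPdist_lt/(_ _ y_gt0)[m _ /(_ m (leqnn m))/= Sxm] := xl.
rewrite -lE mulrDl mul1r -(subrK (x m) l) addrC.
apply: le_trans (ler_normD _ _) _.
by apply: lerD; [exact: Sh_le|exact: ltW].
Qed.

(** * Passage from the operator to its inverse *)

Lemma iter_continuous (X : topologicalType) (f : X -> X) n :
  continuous f -> continuous (iter n f).
Proof.
move=> cf; elim: n => [|n IH] x; first exact: cvg_id.
exact: (continuous_comp (IH x) (cf _)).
Qed.

Lemma iterK (U : Type) (f g : U -> U) n : cancel f g ->
  cancel (iter n f) (iter n g).
Proof. by move=> fK; elim: n => // n IH x; rewrite iterSr/= fK. Qed.

Lemma U_frequently_hypercyclic_inv (R : realType) (X : completeNormedModType K)
    (T S : {linear X -> X}) :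
  continuous T -> continuous S -> cancel T S -> cancel S T ->
  frequently_hypercyclic R T -> U_frequently_hypercyclic R S.
Proof.
move=> cT cS TK SK [x Tx].
(* Arbitrarily late visits to U come from a visit to its preimage under the N-th iterate, nonempty
   as [T] is invertible. *)
have hit (U : set X) N : open U -> U !=set0 ->
    exists2 n, (N <= n)%N & U (iter n T x).
  move=> oU [u Uu].
  have [||a Ta] := density_gt0_nonempty (Tx (iter N T @^-1` U) _ _).
  - by apply: open_comp oU => z _; exact: iter_continuous.
  - by exists (iter N S u); rewrite /preimage/= (iterK N SK).
  - by exists (N + a)%N; [exact: leq_addr|rewrite iterD].
(* The dense orbit of [x] supplies the centers of a countable base. *)
pose V (p : nat * nat) := ball (iter p.1 T x) (p.2.+1%:R^-1 : K).
have V0 p : V p (iter p.1 T x) by apply: ballxx; rewrite invr_gt0.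
have oV p : open (V p) by exact: ball_open.
have /choice[d dP] (p : nat * nat) : exists e : R, 0 < e /\
    exists N, forall n, (N <= n)%N ->
      e <= density_ratio R (return_set T x (V p)) n.
  apply: lower_density_gt0.
  by apply: Tx; [exact: oV|exists (iter p.1 T x)].
pose G (q : nat * nat * nat) := [set y | exists2 n, (q.2 <= n)%N &
  d q.1 <= density_ratio R (return_set S y (V q.1)) n].
(* Only the finitely many times up to n matter, and each visit to an open ball persists near y. *)
have oG q : open (G q).
  rewrite openE => y [n qn dn].
  have : \forall z \near y, forall i : 'I_n.+1,
      return_set S y (V q.1) i -> return_set S z (V q.1) i.
    apply: filter_forall => i.
    have [Vy|nVy] := pselect (return_set S y (V q.1) i); last exact: nearW.
    have cSy : {for y, continuous (iter i S)} by exact: iter_continuous.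
    have : nbhs y (iter i S @^-1` V q.1) by apply: cSy; exact: open_nbhs_nbhs.
    by apply: filterS => z.
  apply: filterS => z yz; exists n => //; apply: le_trans dn _.
  apply: density_ratio_le => a an; exact: (yz (Ordinal (an : (a < n.+1)%N))).
have dG q : dense (G q).
  move=> O O0 oO; have [d0 [N dN]] := dP q.1.
  have [n mn On] := hit O (maxn q.2 N) oO O0.
  exists (iter n T x); split => //; exists n.
    exact: leq_trans (leq_maxl _ _) mn.
  apply: le_trans (dN n (leq_trans (leq_maxr _ _) mn)) _.
  (* For a <= n, applying [S] a times to [iter n T x] gives [iter (n - a) T x]. *)
  rewrite -density_ratio_rev; apply: density_ratio_le => a an.
  by rewrite /return_set/= -{2}(subnKC an) iterD iterK.
(* Integers coding no triple get the whole space, harmless for Baire. *)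
pose F m := if unpickle m is Some q then G q else setT.
have [||y [_ Fy]] := Baire_archimedean (F := F) _ _ openT; last 2 first.
- by exists 0.
- exists y => U oU [u Uu].
  have /nbhs_ballP[e /= e0 eU] : nbhs u U by exact: open_nbhs_nbhs.
  have e20 : 0 < e / 2 by rewrite divr_gt0.
  have [m me] := invSn_lt e20.
  have m0 : 0 < m.+1%:R^-1 :> K by rewrite invr_gt0.
  (* An orbit point within 1/(m+1) of u yields a ball [V (i, m)] inside the ball of radius 2/(m+1) <
     e about u, hence inside U. *)
  have [||i _ ui] := hit (ball u m.+1%:R^-1)° 0%N.
  + exact: open_interior.
  + by exists u; exact: nbhsx_ballx.
  apply: (@upper_density_gt0 _ _ (d (i, m))); first exact: (dP _).1.
  move=> N; have := Fy (pickle (i, m, N)) I; rewrite /F pickleK => -[n Nn dn].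
  exists n => //; apply: le_trans dn _; apply: density_ratio_le => a _.
  move=> Va; apply: eU; apply: le_ball (ball_triangle (interior_subset ui) Va).
  by rewrite [leRHS]splitr lerD// ltW// me.
- move=> m; rewrite /F; case: unpickle => [q|]; first by split.
  by split; [exact: openT|move=> O O0 _; rewrite setIT].
Qed.

End ArchimedeanNormedModule.

Theorem proposition20 (R : realType) (k : scalars)
    (X : completeNormedModType (scalar_field R k))
    (T Tinv : {linear X -> X})
    (T_bounded : bounded_operator T)
    (T_fhc : frequently_hypercyclic R T)
    (TK : cancel T Tinv) (TinvK : cancel Tinv T) :
  bounded_operator Tinv /\ U_frequently_hypercyclic R Tinv.
Proof.
have archK := @scalar_field_archimedean R k.
have Tinv_bounded := bounded_operator_inv archK T_bounded TK TinvK.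
split=> //; apply: (U_frequently_hypercyclic_inv archK _ _ TK TinvK T_fhc);
  exact: bounded_operator_continuous.
Qed.
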